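(* Let $K\subseteq\mathbb{R}$ be a cubic number field having exactly one real embedding (i.e. $K$ has one real and two complex conjugate embeddings into $\mathbb{C}$), and let $\alpha,\beta\in K$. Then there exists a Peck sequence for the pair $(\alpha,\beta)$.
   Context: For $x\in\mathbb{R}$, $\|x\|$ denotes the distance from $x$ to the nearest integer. A Peck sequence for a pair $(\sigma,\tau)$ of real numbers is a strictly increasing sequence $(s_n)_{n\ge1}$ of positive integers for which there exist constants $M_1,M_2>0$ and an infinite subsequence $(\psi_n)_{n\ge1}$ of $(s_n)$ with all $\psi_n\ge 2$, such that for all $n$: $\max\{\|s_n\sigma\|,\|s_n\tau\|\}<\frac{M_1}{s_n^{1/2}}$ and $\|\psi_n\sigma\|<\frac{M_2}{\psi_n^{1/2}\log\psi_n}$. *)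

(* Defs.v *)
From Stdlib Require Import Reals QArith Qreals.
Open Scope R_scope.

Definition dist_nint (x : R) : R := Rmin (frac_part x) (1 - frac_part x).

Definition is_rat (x : R) : Prop := exists q : Q, x = Q2R q.

(** theta is a real number generating a cubic number field with exactly one
    real embedding: theta has degree exactly 3 over Q (root of a rational
    monic cubic, and 1, theta, theta^2 are Q-linearly independent), and that
    cubic (its minimal polynomial) has theta as its only real root. *)
Definition cubic_one_real_generator (theta : R) : Prop :=
  (exists a b c : R, is_rat a /\ is_rat b /\ is_rat c /\
     theta ^ 3 + a * theta ^ 2 + b * theta + c = 0 /\
     (forall y : R, y ^ 3 + a * y ^ 2 + b * y + c = 0 -> y = theta)) /\
  (forall c0 c1 c2 : R, is_rat c0 -> is_rat c1 -> is_rat c2 ->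
     c0 + c1 * theta + c2 * theta ^ 2 = 0 -> c0 = 0 /\ c1 = 0 /\ c2 = 0).

Definition in_Qtheta (theta x : R) : Prop :=
  exists c0 c1 c2 : R, is_rat c0 /\ is_rat c1 /\ is_rat c2 /\
    x = c0 + c1 * theta + c2 * theta ^ 2.

Definition peck_sequence (s : nat -> nat) (sigma tau : R) : Prop :=
  (forall n, (0 < s n)%nat) /\
  (forall n, (s n < s (S n))%nat) /\
  exists M1 M2 : R, 0 < M1 /\ 0 < M2 /\
  exists phi : nat -> nat,
    (forall n, (phi n < phi (S n))%nat) /\
    (forall n, (2 <= s (phi n))%nat) /\
    (forall n, Rmax (dist_nint (INR (s n) * sigma)) (dist_nint (INR (s n) * tau))
               < M1 / sqrt (INR (s n))) /\
    (forall n, dist_nint (INR (s (phi n)) * sigma)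
               < M2 / (sqrt (INR (s (phi n))) * ln (INR (s (phi n))))).

(* Main.v *)
(** Let [t] be an integral generator of the field, with conjugates [t', t''] and
    minimal polynomial [f]. A pigeonhole argument gives a unit [e > 1] of norm 1
    in [Z[t]], so [|e'| = e^(-1/2)]. For [x] in [Z[t]] the coefficient [c] of
    [t^2] in [x] is the trace of [x / f'(t)], hence [c t] and [c t^2] are within
    [O(|x'|)] of integers, while [c] is of order [x]. Taking [x = mu e^n] gives
    errors [O(c^(-1/2))]. If [alpha = A t + B t^2], choosing
    [mu = A - B (p + t)] makes the error at [alpha] a constant times
    [Im (e'^n)], and Dirichlet's theorem applied to [arg e' / pi] gives infinitely
    many [n] for which this is [O(|e'|^n / n)], where [n] is of order [log c].
    These [n] alone already form a Peck sequence. *)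

Require Import Defs.
From Stdlib Require Import Reals QArith Qreals.
From Stdlib Require Import ZArith Lra Lia List Classical IndefiniteDescription.
Open Scope R_scope.

Lemma dist_nint_le_Rabs (x : R) (m : Z) : dist_nint x <= Rabs (x - IZR m).
Proof.
  unfold dist_nint.
  destruct (base_fp x) as [f0 f1].
  pose proof (Rplus_Int_part_frac_part x) as E.
  destruct (Z_le_gt_dec m (Int_part x)) as [H | H].
  - apply IZR_le in H.
    apply Rle_trans with (1 := Rmin_l _ _).
    apply Rle_trans with (2 := Rle_abs _); lra.
  - assert (H1 : (Int_part x + 1 <= m)%Z) by lia.
    apply IZR_le in H1; rewrite plus_IZR in H1.
    apply Rle_trans with (1 := Rmin_r _ _).
    rewrite Rabs_minus_sym.
    apply Rle_trans with (2 := Rle_abs _); lra.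
Qed.

Lemma exists_collision {A : Type} (f : nat -> A) (L : list A) :
  (forall i, In (f i) L) ->
  exists i j, (i < j)%nat /\ (j <= length L)%nat /\ f i = f j.
Proof.
  intros HL.
  apply NNPP; intros Hno.
  assert (Hinj : forall i j, (i < j <= length L)%nat -> f i <> f j).
  { intros i j Hij E; apply Hno; exists i, j; intuition. }
  assert (ND : NoDup (map f (seq 0 (S (length L))))).
  { apply NoDup_map_NoDup_ForallPairs; [| apply seq_NoDup].
    intros i j Hi Hj E; apply in_seq in Hi, Hj.
    destruct (Nat.lt_trichotomy i j) as [H | [H | H]]; auto; exfalso.
    - apply (Hinj i j); auto; lia.
    - apply (Hinj j i); auto; lia. }
  apply NoDup_incl_length with (l' := L) in ND.
  - rewrite length_map, length_seq in ND; lia.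
  - intros y Hy; apply in_map_iff in Hy; destruct Hy as [i [<- _]]; apply HL.
Qed.

Definition zrange (n : nat) : list Z :=
  map (fun k => (Z.of_nat k - Z.of_nat n)%Z) (seq 0 (S (2 * n))).

Lemma in_zrange (n : nat) (z : Z) : (Z.abs z <= Z.of_nat n)%Z -> In z (zrange n).
Proof.
  intros H; apply in_map_iff.
  exists (Z.to_nat (z + Z.of_nat n)); split; [lia | apply in_seq; lia].
Qed.

Lemma dirichlet_approximation (y : nat -> R) (K : nat) : (0 < K)%nat ->
  exists i j m, (i < j)%nat /\ (j <= K)%nat /\
    Rabs (y j - y i - IZR m) <= / INR K.
Proof.
  intros HK.
  assert (HKr : 0 < INR K) by (apply lt_0_INR; lia).
  set (box := fun i => Z.to_nat (Int_part (INR K * frac_part (y i)))).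
  assert (Hbox : forall i, INR (box i) <= INR K * frac_part (y i) < INR (box i) + 1 /\
                           (box i < K)%nat).
  { intros i; destruct (base_fp (y i)) as [f0 f1].
    assert (g0 : 0 <= INR K * frac_part (y i)) by (apply Rmult_le_pos; lra).
    assert (g1 : INR K * frac_part (y i) < INR K) by nra.
    destruct (base_Int_part (INR K * frac_part (y i))) as [b0 b1].
    assert (nn : (0 <= Int_part (INR K * frac_part (y i)))%Z).
    { assert (-1 < Int_part (INR K * frac_part (y i)))%Z; [| lia].
      apply lt_IZR; lra. }
    assert (E : INR (box i) = IZR (Int_part (INR K * frac_part (y i)))).
    { unfold box; rewrite INR_IZR_INZ, Z2Nat.id; auto. }
    split; [lra | apply INR_lt; lra]. }
  destruct (exists_collision box (seq 0 K)) as (i & j & ij & jK & E).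
  { intros i; apply in_seq; destruct (Hbox i); lia. }
  rewrite length_seq in jK.
  exists i, j, (Int_part (y j) - Int_part (y i))%Z; repeat split; auto.
  destruct (Hbox i) as [Hi _], (Hbox j) as [Hj _]; rewrite E in Hi.
  rewrite minus_IZR.
  replace (y j - y i - (IZR (Int_part (y j)) - IZR (Int_part (y i))))
    with (frac_part (y j) - frac_part (y i)) by (unfold frac_part; ring).
  apply Rmult_le_reg_l with (INR K); auto.
  rewrite Rinv_r by lra.
  rewrite <- (Rabs_pos_eq (INR K)) at 1 by lra.
  rewrite <- Rabs_mult; apply Rabs_le; lra.
Qed.

Lemma Rabs_sin_le (x : R) : Rabs (sin x) <= Rabs x.
Proof.
  assert (H : forall y, 0 <= y -> Rabs (sin y) <= y).
  { intros y Hy; destruct (Rle_lt_or_eq_dec 0 y Hy) as [Hy' | <-].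
    - apply Rabs_le; split; [| left; apply sin_lt_x; auto].
      destruct (Rle_dec y PI) as [H | H].
      + pose proof (sin_ge_0 y Hy H); lra.
      + pose proof (SIN_bound y); pose proof PI2_1; unfold PI2 in *; lra.
    - rewrite sin_0, Rabs_R0; lra. }
  unfold Rabs at 2; destruct (Rcase_abs x) as [Hx | Hx].
  - rewrite <- Rabs_Ropp, <- sin_neg; apply H; lra.
  - apply H; lra.
Qed.

Lemma sin_shift_abs (x : R) (k : Z) : Rabs (sin (x - IZR k * PI)) = Rabs (sin x).
Proof.
  assert (S0 : sin (IZR k * PI) = 0) by (apply sin_eq_0_1; exists k; auto).
  assert (C1 : Rabs (cos (IZR k * PI)) = 1).
  { pose proof (sin2_cos2 (IZR k * PI)) as E; rewrite S0 in E; unfold Rsqr in E.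
    apply Rsqr_inj; [apply Rabs_pos | lra |].
    rewrite <- Rsqr_abs; unfold Rsqr; lra. }
  rewrite sin_minus, S0, Rmult_0_r, Rminus_0_r, Rabs_mult, C1; ring.
Qed.

Lemma sin_multiple_small (w : R) (n0 : nat) :
  exists n, (n0 <= n)%nat /\ (0 < n)%nat /\ Rabs (sin (INR n * w)) <= PI / INR n.
Proof.
  pose proof PI_RGT_0 as HPI.
  destruct (classic (exists k, (0 < k)%nat /\ sin (INR k * w) = 0)) as [[k [Hk E]] | Hno].
  - exists (k * S n0)%nat; split; [nia | split; [nia |]].
    apply sin_eq_0_0 in E; destruct E as [j E].
    replace (INR (k * S n0) * w) with (IZR (j * Z.of_nat (S n0)) * PI).
    + rewrite sin_eq_0_1 by (eexists; reflexivity).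
      rewrite Rabs_R0; apply Rlt_le, Rdiv_lt_0_compat; auto.
      apply lt_0_INR; nia.
    + rewrite mult_IZR, <- INR_IZR_INZ, mult_INR.
      transitivity (INR (S n0) * (INR k * w)); [rewrite E |]; ring.
  - assert (Hmin : exists d, 0 < d /\
      forall k, (0 < k < n0)%nat -> d <= Rabs (sin (INR k * w))).
    { clear - Hno; induction n0 as [| n [d [d0 Hd]]].
      - exists 1; split; [lra | intros; lia].
      - destruct (Nat.eq_dec n 0) as [-> | Hn].
        + exists 1; split; [lra | intros; lia].
        + exists (Rmin d (Rabs (sin (INR n * w)))); split.
          * apply Rmin_pos; auto.
            apply Rabs_pos_lt; intros E; apply Hno; exists n; split; [lia | auto].
          * intros k Hk; destruct (Nat.eq_dec k n) as [-> | Hkn]; [apply Rmin_r |].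
            apply Rle_trans with (1 := Rmin_l _ _), Hd; lia. }
    destruct Hmin as [d [d0 Hd]].
    destruct (INR_unbounded (PI / d)) as [K HK].
    assert (K0 : 0 < INR K).
    { apply Rlt_trans with (2 := HK), Rdiv_lt_0_compat; auto. }
    destruct (dirichlet_approximation (fun i => INR i * (w / PI)) K) as (i & j & m & ij & jK & H).
    { apply INR_lt; auto. }
    set (n := (j - i)%nat).
    assert (Hs : Rabs (sin (INR n * w)) <= PI / INR K).
    { rewrite <- (sin_shift_abs _ m).
      apply Rle_trans with (1 := Rabs_sin_le _).
      replace (INR n * w - IZR m * PI) with (PI * (INR j * (w / PI) - INR i * (w / PI) - IZR m)).
      - rewrite Rabs_mult, (Rabs_pos_eq PI) by lra.
        apply Rmult_le_compat_l; [lra | exact H].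
      - unfold n; rewrite minus_INR by lia; field; lra. }
    exists n; repeat split.
    + destruct (le_lt_dec n0 n) as [|Hlt]; auto; exfalso.
      assert (d <= PI / INR K) by (eapply Rle_trans; [apply Hd | exact Hs]; unfold n in *; lia).
      assert (PI / INR K < d); [| lra].
      apply Rmult_lt_reg_r with (INR K); auto.
      apply (Rmult_lt_compat_r d) in HK; auto.
      unfold Rdiv in *; rewrite Rmult_assoc, Rinv_l in * by lra; lra.
    + unfold n; lia.
    + apply Rle_trans with (1 := Hs).
      apply Rmult_le_compat_l; [lra |].
      apply Rinv_le_contravar; [apply lt_0_INR | apply le_INR]; unfold n; lia.
Qed.

Lemma polar_form (a b rho : R) : 0 < rho -> a * a + b * b = rho * rho ->
  exists w, a = rho * cos w /\ b = rho * sin w.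
Proof.
  intros Hr E.
  assert (Ec : (a / rho) * (a / rho) + (b / rho) * (b / rho) = 1).
  { replace (_ + _) with ((a * a + b * b) / (rho * rho)) by (field; lra).
    rewrite E; field; lra. }
  assert (Hc : -1 <= a / rho <= 1) by nra.
  assert (Es : sqrt (1 - Rsqr (a / rho)) = Rabs (b / rho)).
  { rewrite <- sqrt_Rsqr_abs; f_equal; unfold Rsqr; lra. }
  destruct (Rle_dec 0 (b / rho)) as [Hb | Hb].
  - exists (acos (a / rho)); rewrite cos_acos, sin_acos, Es, Rabs_pos_eq by auto.
    split; field; lra.
  - exists (- acos (a / rho)); rewrite cos_neg, sin_neg, cos_acos, sin_acos, Es by auto.
    rewrite Rabs_left by lra; split; field; lra.
Qed.

Record elt := Elt { c0 : Z; c1 : Z; c2 : Z }.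

(* [Elt a b c] stands for [a + b t + c t^2], where [t^3 + p t^2 + q t + r = 0]
   has the roots [theta] and [u +- i v]; [re] and [im] give the image under
   [t |-> u + i v]. Writing [p], [q], [r] through [theta], [u], [v] turns every
   statement about conjugates into a polynomial identity. *)
Section CubicRing.

Variables (p q r : Z) (theta u v : R).
Hypothesis Hp : IZR p = - (theta + 2 * u).
Hypothesis Hq : IZR q = 2 * theta * u + u * u + v * v.
Hypothesis Hr : IZR r = - theta * (u * u + v * v).
Hypothesis Hv : 0 < v.
Hypothesis Hind : forall a b c : Z,
  IZR a + IZR b * theta + IZR c * (theta * theta) = 0 ->
  a = 0%Z /\ b = 0%Z /\ c = 0%Z.

Definition ev (x : elt) : R :=
  IZR (c0 x) + IZR (c1 x) * theta + IZR (c2 x) * (theta * theta).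
Definition re (x : elt) : R :=
  IZR (c0 x) + IZR (c1 x) * u + IZR (c2 x) * (u * u - v * v).
Definition im (x : elt) : R := v * (IZR (c1 x) + 2 * IZR (c2 x) * u).
Definition conj_normsq (x : elt) : R := re x * re x + im x * im x.

Definition mul_gen (x : elt) : elt :=
  Elt (- c2 x * r) (c0 x - c2 x * q) (c1 x - c2 x * p).

Definition mul (x y : elt) : elt :=
  let xt := mul_gen x in
  let xtt := mul_gen xt in
  Elt (c0 y * c0 x + c1 y * c0 xt + c2 y * c0 xtt)
      (c0 y * c1 x + c1 y * c1 xt + c2 y * c1 xtt)
      (c0 y * c2 x + c1 y * c2 xt + c2 y * c2 xtt).

(* The first row of the adjugate of the matrix of multiplication by [x]. *)
Definition adj (x : elt) : elt :=
  let xt := mul_gen x in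
  let xtt := mul_gen xt in
  Elt (c1 xt * c2 xtt - c2 xt * c1 xtt)
      (c2 x * c1 xtt - c1 x * c2 xtt)
      (c1 x * c2 xt - c2 x * c1 xt).

Definition nrm (x : elt) : Z := c0 (mul x (adj x)).

Fixpoint pow_elt (x : elt) (n : nat) : elt :=
  match n with
  | O => Elt 1 0 0
  | S k => mul x (pow_elt x k)
  end.

Ltac expand_ring :=
  unfold conj_normsq, nrm, ev, re, im, adj, mul, mul_gen; simpl;
  repeat rewrite ?minus_IZR, ?plus_IZR, ?mult_IZR, ?opp_IZR;
  rewrite ?Hp, ?Hq, ?Hr.

Lemma ev_mul (x y : elt) : ev (mul x y) = ev x * ev y.
Proof. expand_ring; ring. Qed.

Lemma re_mul (x y : elt) : re (mul x y) = re x * re y - im x * im y.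
Proof. expand_ring; ring. Qed.

Lemma im_mul (x y : elt) : im (mul x y) = re x * im y + im x * re y.
Proof. expand_ring; ring. Qed.

Lemma mul_adj (x : elt) : mul x (adj x) = Elt (nrm x) 0 0.
Proof. unfold nrm, adj, mul, mul_gen; simpl; f_equal; ring. Qed.

Lemma ev_adj (x : elt) : ev x * ev (adj x) = IZR (nrm x).
Proof. rewrite <- ev_mul, mul_adj; unfold ev; simpl; ring. Qed.

Lemma nrm_conj (x : elt) : IZR (nrm x) = ev x * conj_normsq x.
Proof. expand_ring; ring. Qed.

Lemma conj_normsq_mul (x y : elt) :
  conj_normsq (mul x y) = conj_normsq x * conj_normsq y.
Proof. unfold conj_normsq; rewrite re_mul, im_mul; ring. Qed.

Lemma conj_normsq_pos (x : elt) : ev x <> 0 -> 0 < conj_normsq x.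
Proof.
  intros Hx; unfold conj_normsq.
  destruct (Rlt_dec 0 (re x * re x + im x * im x)) as [| H]; auto; exfalso.
  assert (Hre : re x = 0) by nra.
  assert (Him : im x = 0) by nra.
  unfold im in Him; apply Rmult_integral in Him; destruct Him as [Him | Him]; [lra |].
  destruct (Hind (c1 x - c2 x * p) (- c2 x) 0) as (E1 & E2 & _).
  { rewrite minus_IZR, mult_IZR, opp_IZR, Hp; lra. }
  assert (E : c2 x = 0%Z) by lia.
  rewrite E in E1; simpl in E1; rewrite Z.sub_0_r in E1.
  apply Hx; unfold ev, re in *; rewrite E, E1 in *; lra.
Qed.

Lemma exists_small_elements :
  exists B : nat, forall d : R, exists x : elt,
    0 < d -> 0 < Rabs (ev x) < d /\ (Z.abs (nrm x) <= Z.of_nat B)%Z.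
Proof.
  set (C := Rabs theta + Rabs (theta * theta) + 1 + Rabs u + Rabs (u * u - v * v)).
  set (D := v * (1 + 2 * Rabs u)).
  destruct (INR_unbounded (C * C + D * D)) as [B HB].
  exists B; intros d.
  destruct (classic (0 < d)) as [Hd | Hd]; [| exists (Elt 0 0 0); contradiction].
  destruct (INR_unbounded (/ d + 1)) as [H HH].
  assert (HH1 : 1 < INR H) by (pose proof (Rinv_0_lt_compat d Hd); lra).
  assert (H1 : (1 < H)%nat) by (apply INR_lt; auto).
  set (y := fun k => INR (k / S H) * theta + INR (k mod S H) * (theta * theta)).
  destruct (dirichlet_approximation y (S H * S H - 1)) as (i & j & m & ij & jK & Hm); [nia |].
  set (x := Elt (- m) (Z.of_nat (j / S H) - Z.of_nat (i / S H))
                (Z.of_nat (j mod S H) - Z.of_nat (i mod S H))).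
  assert (Ex : ev x = y j - y i - IZR m).
  { unfold ev, y, x; cbn beta iota delta [c0 c1 c2].
    rewrite !minus_IZR, opp_IZR, <- !INR_IZR_INZ; ring. }
  assert (Hquo : forall k, (k < S H * S H)%nat -> (k / S H <= H)%nat).
  { intros k Hk; assert (k / S H < S H)%nat by (apply Nat.Div0.div_lt_upper_bound; auto); lia. }
  assert (Hmod : forall k, (k mod S H <= H)%nat).
  { intros k; assert (k mod S H < S H)%nat by (apply Nat.mod_upper_bound; lia); lia. }
  assert (Hc1 : Rabs (IZR (c1 x)) <= INR H).
  { rewrite <- abs_IZR, INR_IZR_INZ; apply IZR_le; unfold x; cbn [c1].
    pose proof (Hquo i ltac:(lia)); pose proof (Hquo j ltac:(lia)); lia. }
  assert (Hc2 : Rabs (IZR (c2 x)) <= INR H).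
  { rewrite <- abs_IZR, INR_IZR_INZ; apply IZR_le; unfold x; cbn [c2].
    pose proof (Hmod i); pose proof (Hmod j); lia. }
  assert (Hne : ev x <> 0).
  { intros E; apply Hind in E; destruct E as (_ & E1 & E2); unfold x in E1, E2; cbn [c1 c2] in E1, E2.
    pose proof (Nat.div_mod_eq i (S H)); pose proof (Nat.div_mod_eq j (S H)); nia. }
  assert (Hev : Rabs (ev x) <= / (INR H * INR H)).
  { rewrite Ex; apply Rle_trans with (1 := Hm).
    apply Rinv_le_contravar; [nra |].
    rewrite <- mult_INR; apply le_INR; nia. }
  assert (Hev1 : Rabs (ev x) <= 1).
  { apply Rle_trans with (1 := Hev); rewrite <- Rinv_1; apply Rinv_le_contravar; nra. }
  exists x; intros _; split; [split |].
  - apply Rabs_pos_lt; auto.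
  - apply Rle_lt_trans with (1 := Hev).
    rewrite <- (Rinv_inv d); apply Rinv_lt_contravar; [| nra].
    pose proof (Rinv_0_lt_compat d Hd); apply Rmult_lt_0_compat; nra.
  - assert (Hre : Rabs (re x) <= C * INR H).
    { replace (re x) with (ev x + (- (IZR (c1 x) * theta) + (- (IZR (c2 x) * (theta * theta))
        + (IZR (c1 x) * u + IZR (c2 x) * (u * u - v * v))))) by (unfold ev, re; ring).
      eapply Rle_trans; [apply Rabs_triang |].
      eapply Rle_trans; [apply Rplus_le_compat_l, Rabs_triang |].
      eapply Rle_trans; [do 2 apply Rplus_le_compat_l; apply Rabs_triang |].
      eapply Rle_trans; [do 3 apply Rplus_le_compat_l; apply Rabs_triang |].
      rewrite !Rabs_Ropp, (Rabs_mult _ theta), (Rabs_mult _ (theta * theta)),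
        (Rabs_mult _ u), (Rabs_mult _ (u * u - v * v)).
      assert (Hmul : forall a b, a <= INR H -> a * Rabs b <= INR H * Rabs b)
        by (intros; apply Rmult_le_compat_r; auto using Rabs_pos).
      pose proof (Hmul _ theta Hc1); pose proof (Hmul _ (theta * theta) Hc2).
      pose proof (Hmul _ u Hc1); pose proof (Hmul _ (u * u - v * v) Hc2).
      unfold C; lra. }
    assert (Him : Rabs (im x) <= D * INR H).
    { unfold im, D; rewrite Rabs_mult, (Rabs_pos_eq v), (Rmult_assoc v (1 + 2 * Rabs u)) by lra.
      apply Rmult_le_compat_l; [lra |].
      eapply Rle_trans; [apply Rabs_triang |].
      rewrite !Rabs_mult, (Rabs_pos_eq 2) by lra.
      assert (Rabs (IZR (c2 x)) * Rabs u <= INR H * Rabs u)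
        by (apply Rmult_le_compat_r; auto using Rabs_pos).
      lra. }
    apply le_IZR; rewrite abs_IZR, nrm_conj, Rabs_mult, <- INR_IZR_INZ.
    apply Rlt_le, Rle_lt_trans with (2 := HB).
    assert (Hsq : forall a b, Rabs a <= b -> a * a <= b * b).
    { intros a b Hab; apply Rsqr_le_abs_1; rewrite (Rabs_pos_eq b); auto.
      apply Rle_trans with (2 := Hab), Rabs_pos. }
    assert (Hcn : Rabs (conj_normsq x) <= (C * C + D * D) * (INR H * INR H)).
    { unfold conj_normsq; rewrite Rabs_pos_eq by nra.
      pose proof (Hsq _ _ Hre); pose proof (Hsq _ _ Him); lra. }
    apply Rle_trans with (/ (INR H * INR H) * ((C * C + D * D) * (INR H * INR H))).
    + apply Rmult_le_compat; auto using Rabs_pos.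
    + right; field; lra.
Qed.

(* Two elements with the same norm [n] that agree modulo [n] have a quotient in
   the ring: [x / y = 1 + ((x - y) / n) * adj y]. *)
Lemma exists_quotient (x y : elt) : ev y <> 0 -> nrm x = nrm y ->
  (c0 x mod nrm y = c0 y mod nrm y)%Z ->
  (c1 x mod nrm y = c1 y mod nrm y)%Z ->
  (c2 x mod nrm y = c2 y mod nrm y)%Z ->
  exists e : elt, ev e * ev y = ev x.
Proof.
  intros Hy En E0 E1 E2.
  assert (Hn : nrm y <> 0%Z).
  { intros E; apply (f_equal IZR) in E; rewrite nrm_conj in E.
    pose proof (conj_normsq_pos y Hy).
    apply Rmult_integral in E; destruct E; lra. }
  assert (Hdiv : forall a b : Z, (a mod nrm y = b mod nrm y)%Z ->
            IZR a = IZR b + IZR (nrm y) * IZR (a / nrm y - b / nrm y)).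
  { intros a b E; rewrite <- mult_IZR, <- plus_IZR; f_equal.
    pose proof (Z.div_mod a (nrm y) Hn); pose proof (Z.div_mod b (nrm y) Hn); lia. }
  set (w := Elt (c0 x / nrm y - c0 y / nrm y) (c1 x / nrm y - c1 y / nrm y)
                (c2 x / nrm y - c2 y / nrm y)).
  assert (Ew : ev x = ev y + IZR (nrm y) * ev w).
  { unfold ev; rewrite (Hdiv _ _ E0), (Hdiv _ _ E1), (Hdiv _ _ E2).
    unfold w; cbn [c0 c1 c2]; ring. }
  set (z := mul w (adj y)).
  exists (Elt (1 + c0 z) (c1 z) (c2 z)).
  rewrite Ew, <- ev_adj.
  transitivity (ev y * (1 + ev z)).
  - unfold ev; cbn [c0 c1 c2]; rewrite plus_IZR; ring.
  - unfold z; rewrite ev_mul; ring.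
Qed.

Lemma exists_unit : exists e : elt, 1 < ev e /\ ev e * conj_normsq e = 1.
Proof.
  destruct exists_small_elements as [B HB].
  apply functional_choice in HB; destruct HB as [F HF].
  set (y := fix y n := match n with O => F 1 | S k => F (Rabs (ev (y k))) end).
  assert (Hpos : forall n, 0 < Rabs (ev (y n)) /\ (Z.abs (nrm (y n)) <= Z.of_nat B)%Z).
  { induction n as [| n [IH _]].
    - destruct (HF 1 Rlt_0_1) as [[H _] HN]; auto.
    - destruct (HF _ IH) as [[H _] HN]; auto. }
  assert (Hdec : forall i j, (i < j)%nat -> Rabs (ev (y j)) < Rabs (ev (y i))).
  { intros i j H; induction H as [| j H IH].
    - destruct (HF _ (proj1 (Hpos i))) as [[_ H] _]; exact H.
    - apply Rlt_trans with (2 := IH).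
      destruct (HF _ (proj1 (Hpos j))) as [[_ H0] _]; exact H0. }
  assert (Hnz : forall n, ev (y n) <> 0).
  { intros n E; destruct (Hpos n) as [H _]; rewrite E, Rabs_R0 in H; lra. }
  assert (Hnn : forall n, nrm (y n) <> 0%Z).
  { intros n E; apply (f_equal IZR) in E; rewrite nrm_conj in E.
    pose proof (conj_normsq_pos _ (Hnz n)).
    apply Rmult_integral in E; destruct E; [apply (Hnz n); auto | lra]. }
  set (key := fun n => let N := nrm (y n) in
    (N, (c0 (y n) mod N, (c1 (y n) mod N, c2 (y n) mod N)))%Z).
  destruct (exists_collision key (list_prod (zrange B) (list_prod (zrange B)
    (list_prod (zrange B) (zrange B))))) as (i & j & ij & _ & E).
  { intros n; destruct (Hpos n) as [_ HN].
    assert (Hm : forall a, In (a mod nrm (y n))%Z (zrange B)).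
    { intros a; apply in_zrange.
      assert (Z.abs (a mod nrm (y n)) < Z.abs (nrm (y n)))%Z; [| lia].
      apply Z.mod_bound_abs; auto. }
    unfold key; cbv zeta; repeat apply in_prod; auto using in_zrange. }
  unfold key in E; cbv zeta in E; injection E as En E0 E1 E2.
  rewrite En in E0, E1, E2.
  destruct (exists_quotient (y i) (y j)) as [e He]; auto.
  assert (Ne : ev e * conj_normsq e = 1).
  { assert (H2 : conj_normsq e * conj_normsq (y j) = conj_normsq (y i)).
    { assert (Hinj : forall a b, ev a = ev b -> a = b).
      { intros [a0 a1 a2] [b0 b1 b2] Hab.
        destruct (Hind (a0 - b0) (a1 - b1) (a2 - b2)) as (H3 & H4 & H5).
        - unfold ev in Hab; cbn [c0 c1 c2] in Hab; rewrite !minus_IZR; lra.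
        - f_equal; lia. }
      rewrite <- conj_normsq_mul; f_equal; apply Hinj; rewrite ev_mul; auto. }
    pose proof (nrm_conj (y i)) as H3; pose proof (nrm_conj (y j)) as H4.
    rewrite En, H4, <- He, <- H2 in H3.
    pose proof (conj_normsq_pos _ (Hnz j)).
    apply Rmult_eq_reg_l with (ev (y j) * conj_normsq (y j)); [lra |].
    apply Rmult_integral_contrapositive_currified; [auto | lra]. }
  exists e; split; auto.
  assert (Hep : 0 < ev e).
  { assert (0 <= conj_normsq e) by (unfold conj_normsq; nra).
    destruct (Rlt_dec 0 (ev e)); auto; nra. }
  pose proof (Hdec _ _ ij) as Hlt; rewrite <- He, Rabs_mult, (Rabs_pos_eq (ev e)) in Hlt by lra.
  destruct (Hpos j) as [Hj _]; nra.
Qed.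

Lemma ev_pow (e : elt) (n : nat) : ev (pow_elt e n) = ev e ^ n.
Proof.
  induction n as [| n IH]; simpl.
  - unfold ev; simpl; ring.
  - rewrite ev_mul, IH; ring.
Qed.

Lemma conj_pow (e : elt) (rho w : R) (n : nat) :
  re e = rho * cos w -> im e = rho * sin w ->
  re (pow_elt e n) = rho ^ n * cos (INR n * w) /\
  im (pow_elt e n) = rho ^ n * sin (INR n * w).
Proof.
  intros Er Ei; induction n as [| n [IHr IHi]].
  - simpl; rewrite Rmult_0_l, cos_0, sin_0; unfold re, im; simpl; split; ring.
  - rewrite S_INR, Rmult_plus_distr_r, Rmult_1_l, cos_plus, sin_plus; simpl pow_elt.
    rewrite re_mul, im_mul, IHr, IHi, Er, Ei; simpl pow; split; ring.
Qed.

Definition near_gen (x : elt) : Z := (c1 x - c2 x * p)%Z.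
Definition near_gen2 (x : elt) : Z := (c0 x - c2 x * q - p * near_gen x)%Z.

Lemma near_gen_error (x : elt) :
  IZR (c2 x) * theta - IZR (near_gen x) = - (im x / v).
Proof.
  unfold near_gen, im; rewrite minus_IZR, mult_IZR, Hp; field; lra.
Qed.

Lemma near_gen2_error (x : elt) :
  IZR (c2 x) * (theta * theta) - IZR (near_gen2 x) = - (theta + u) * (im x / v) - re x.
Proof.
  unfold near_gen2, near_gen, im, re.
  repeat rewrite ?minus_IZR, ?mult_IZR; rewrite Hp, Hq; field; lra.
Qed.

(* For [mu = twist A B] and [al = A t + B t^2] with conjugates [mu'], [mu''], ...,
   one has [al - al' = (t - t') mu''], so [mu' (al - al') / f'(t')] equals
   [- |mu'|^2 / (t' - t'')], which is purely imaginary: only [im e] survives in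
   the error. *)
Definition twist (A B : Z) : elt := Elt (A - B * p) (- B) 0.

Lemma twist_error (A B : Z) (e : elt) :
  let x := mul (twist A B) e in
  IZR (c2 x) * (IZR A * theta + IZR B * (theta * theta))
    - IZR (A * near_gen x + B * near_gen2 x)
  = - (conj_normsq (twist A B) * (im e / v)).
Proof.
  intros x.
  replace (_ - _) with (IZR A * (IZR (c2 x) * theta - IZR (near_gen x))
    + IZR B * (IZR (c2 x) * (theta * theta) - IZR (near_gen2 x)))
    by (rewrite plus_IZR, !mult_IZR; ring).
  rewrite near_gen_error, near_gen2_error; unfold x, conj_normsq.
  rewrite re_mul, im_mul; unfold twist, re, im; cbn [c0 c1 c2].
  rewrite minus_IZR, opp_IZR, mult_IZR, Hp; field; lra.
Qed.

Lemma c2_formula (x : elt) :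
  IZR (c2 x) * ((theta - u) * (theta - u) + v * v) = ev x - re x - (theta - u) * (im x / v).
Proof. unfold ev, re, im; field; lra. Qed.

Lemma twist_neq_0 (A B : Z) : A <> 0%Z \/ B <> 0%Z -> ev (twist A B) <> 0.
Proof.
  intros H E; apply Hind in E; cbn [twist c0 c1 c2] in E; destruct E as (E0 & E1 & _).
  assert (B = 0%Z) by lia; subst B; lia.
Qed.

Lemma exists_twist (A B : Z) :
  exists (x0 : elt) (L : R), ev x0 <> 0 /\ 0 <= L /\
    forall e, exists m : Z,
      Rabs (IZR (c2 (mul x0 e)) * (IZR A * theta + IZR B * (theta * theta)) - IZR m)
        <= L * Rabs (im e).
Proof.
  destruct (classic (A = 0%Z /\ B = 0%Z)) as [[-> ->] | H].
  - exists (Elt 1 0 0), 0; split; [unfold ev; simpl; lra | split; [lra |]].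
    intros e; exists 0%Z; rewrite !Rmult_0_l, Rplus_0_r, Rmult_0_r, Rminus_0_r, Rabs_R0; lra.
  - assert (Hn : A <> 0%Z \/ B <> 0%Z) by (destruct (Z.eq_dec A 0); tauto).
    pose proof (conj_normsq_pos _ (twist_neq_0 A B Hn)) as Hc.
    exists (twist A B), (conj_normsq (twist A B) / v); split; [apply twist_neq_0; auto | split].
    + apply Rlt_le, Rdiv_lt_0_compat; auto.
    + intros e; exists (A * near_gen (mul (twist A B) e) + B * near_gen2 (mul (twist A B) e))%Z.
      rewrite twist_error, Rabs_Ropp.
      right; unfold Rdiv; rewrite !Rabs_mult, Rabs_inv, (Rabs_pos_eq v),
        (Rabs_pos_eq (conj_normsq _)) by lra; ring.
Qed.

Lemma good_multiples (A B : Z) :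
  exists K : R, 0 < K /\ forall T : R, exists c m1 m2 m3 : Z,
    T < Rabs (IZR c) /\
    Rabs (IZR c * theta - IZR m1) <= K / sqrt (Rabs (IZR c)) /\
    Rabs (IZR c * (theta * theta) - IZR m2) <= K / sqrt (Rabs (IZR c)) /\
    Rabs (IZR c * (IZR A * theta + IZR B * (theta * theta)) - IZR m3)
      <= K / (sqrt (Rabs (IZR c)) * ln (Rabs (IZR c))).
Proof.
  destruct exists_unit as (e & He & Ne).
  destruct (exists_twist A B) as (x0 & L & Hx0 & HL & Herr).
  assert (Hcp : 0 < conj_normsq e) by nra.
  set (rho := sqrt (conj_normsq e)).
  assert (Hrho : 0 < rho) by (apply sqrt_lt_R0; auto).
  assert (Erho : rho * rho = conj_normsq e) by (apply sqrt_sqrt; lra).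
  destruct (polar_form (re e) (im e) rho Hrho) as (w & Ere & Eim); [auto |].
  set (m := Rabs (ev x0)).
  assert (Hm : 0 < m) by (apply Rabs_pos_lt; auto).
  set (F := (theta - u) * (theta - u) + v * v).
  assert (HF : 0 < F).
  { pose proof (Rle_0_sqr (theta - u)); pose proof (Rmult_lt_0_compat v v Hv Hv).
    unfold F, Rsqr in *; lra. }
  set (s := sqrt (conj_normsq x0)).
  assert (Es : s * s = conj_normsq x0) by (apply sqrt_sqrt, Rlt_le, conj_normsq_pos; auto).
  assert (Hs : 0 <= s) by apply sqrt_pos.
  set (L1 := s + Rabs (theta - u) * (s / v)).
  set (G := 2 * m / F).
  assert (HG : 0 < G) by (apply Rdiv_lt_0_compat; lra).
  set (G' := Rabs (ln G) + ln (ev e)).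
  assert (Hle : 0 < ln (ev e)) by (rewrite <- ln_1; apply ln_increasing; lra).
  assert (HG' : 0 < G') by (unfold G'; pose proof (Rabs_pos (ln G)); lra).
  set (K1 := s / v * sqrt G).
  set (K2 := (Rabs (theta + u) * (s / v) + s) * sqrt G).
  set (K3 := L * sqrt G * (PI * G')).
  pose proof PI_RGT_0 as HPI.
  pose proof (sqrt_pos G) as HsG.
  assert (Hsv : 0 <= s / v) by (apply Rle_mult_inv_pos; auto).
  assert (HK1 : 0 <= K1) by (apply Rmult_le_pos; auto).
  assert (HK2 : 0 <= K2).
  { apply Rmult_le_pos; auto; apply Rplus_le_le_0_compat; auto.
    apply Rmult_le_pos; auto using Rabs_pos. }
  assert (HK3 : 0 <= K3) by (unfold K3; apply Rmult_le_pos; apply Rmult_le_pos; lra).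
  assert (HL1 : 0 <= L1).
  { apply Rplus_le_le_0_compat; auto; apply Rmult_le_pos; auto using Rabs_pos. }
  exists (K1 + K2 + K3 + 1); split; [lra | intros T].
  destruct (Pow_x_infinity (ev e)) with (b := (2 * L1 + 2 * F * (Rmax T 2 + 1)) / m) as [N HN].
  { rewrite Rabs_pos_eq; lra. }
  destruct (sin_multiple_small w N) as (n & HnN & Hn0 & Hsin).
  specialize (HN n HnN); rewrite Rabs_pos_eq in HN by (apply pow_le; lra).
  set (E := ev e ^ n) in *.
  assert (HE : 0 < E) by (apply pow_lt; lra).
  set (t := rho ^ n).
  assert (Ht : 0 < t) by (apply pow_lt; auto).
  assert (EtE : t * t * E = 1).
  { unfold t, E; rewrite <- !Rpow_mult_distr, Erho, (Rmult_comm (conj_normsq e)), Ne.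
    apply pow1. }
  assert (HE1 : 1 <= E) by (apply pow_R1_Rle; lra).
  assert (Ht1 : t <= 1) by nra.
  destruct (conj_pow e rho w n Ere Eim) as [Erp Eip]; fold t in Erp, Eip.
  set (x := mul x0 (pow_elt e n)).
  assert (Hcx : conj_normsq x = (s * t) * (s * t)).
  { unfold x; rewrite conj_normsq_mul, <- Es; unfold conj_normsq at 1; rewrite Erp, Eip.
    pose proof (sin2_cos2 (INR n * w)) as H; unfold Rsqr in H.
    transitivity (s * s * (t * t) * (sin (INR n * w) * sin (INR n * w)
      + cos (INR n * w) * cos (INR n * w))); [ring | rewrite H; ring]. }
  assert (Hst : 0 <= s * t) by (apply Rmult_le_pos; lra).
  assert (Hre : Rabs (re x) <= s * t).
  { rewrite <- (Rabs_pos_eq (s * t)) by auto; apply Rsqr_le_abs_0.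
    unfold conj_normsq in Hcx; unfold Rsqr; nra. }
  assert (Him : Rabs (im x / v) <= s / v * t).
  { unfold Rdiv; rewrite Rabs_mult, Rabs_inv, (Rabs_pos_eq v) by lra.
    replace (s * / v * t) with (s * t * / v) by ring.
    apply Rmult_le_compat_r; [left; apply Rinv_0_lt_compat; auto |].
    rewrite <- (Rabs_pos_eq (s * t)) by auto; apply Rsqr_le_abs_0.
    unfold conj_normsq in Hcx; unfold Rsqr; nra. }
  assert (Hb : 2 * L1 + 2 * F * (Rmax T 2 + 1) <= m * E).
  { apply Rge_le, (Rmult_le_compat_l m) in HN; [| lra].
    replace (m * (_ / m)) with (2 * L1 + 2 * F * (Rmax T 2 + 1)) in HN by (field; lra); auto. }
  set (c := c2 x).
  assert (Hdiff : Rabs (IZR c * F - ev x) <= L1).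
  { unfold c, F; rewrite c2_formula.
    replace (_ - _) with (- re x + - ((theta - u) * (im x / v))) by ring.
    eapply Rle_trans; [apply Rabs_triang |].
    rewrite !Rabs_Ropp, Rabs_mult; unfold L1; apply Rplus_le_compat; [nra |].
    apply Rmult_le_compat_l; [apply Rabs_pos | nra]. }
  assert (Hevx : Rabs (ev x) = m * E).
  { unfold x; rewrite ev_mul, ev_pow, Rabs_mult, (Rabs_pos_eq (ev e ^ n)); auto.
    apply pow_le; lra. }
  assert (HcF : Rabs (IZR c * F) = Rabs (IZR c) * F).
  { rewrite Rabs_mult, (Rabs_pos_eq F); lra. }
  assert (Hlow : m * E - L1 <= Rabs (IZR c) * F).
  { pose proof (Rabs_triang_inv (ev x) (ev x - IZR c * F)) as H.
    replace (ev x - (ev x - IZR c * F)) with (IZR c * F) in H by ring.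
    rewrite Rabs_minus_sym in Hdiff; lra. }
  assert (Hup : Rabs (IZR c) * F <= m * E + L1).
  { pose proof (Rabs_triang_inv (IZR c * F) (ev x)); lra. }
  assert (HcT : Rmax T 2 < Rabs (IZR c)).
  { apply Rmult_lt_reg_r with F; auto.
    assert (0 <= Rmax T 2) by (apply Rle_trans with (2 := Rmax_r _ _); lra).
    assert (0 <= F * Rmax T 2) by (apply Rmult_le_pos; lra).
    lra. }
  pose proof (Rmax_l T 2) as HT1; pose proof (Rmax_r T 2) as HT2.
  assert (HcG : Rabs (IZR c) <= G * E).
  { apply Rmult_le_reg_r with F; auto.
    assert (0 <= F * Rmax T 2) by (apply Rmult_le_pos; lra).
    replace (G * E * F) with (2 * m * E) by (unfold G; field; lra); lra. }
  set (a := Rabs (IZR c)) in *.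
  assert (Hsa : 0 < sqrt a) by (apply sqrt_lt_R0; lra).
  assert (Hta : t <= sqrt G / sqrt a).
  { apply Rmult_le_reg_r with (sqrt a); auto.
    unfold Rdiv; rewrite Rmult_assoc, Rinv_l, Rmult_1_r by lra.
    apply sqrt_le_1_alt in HcG; rewrite sqrt_mult in HcG by lra.
    assert (EE : t * sqrt E = 1).
    { rewrite <- (sqrt_square t) at 1 by lra.
      rewrite <- sqrt_mult by nra; rewrite EtE; apply sqrt_1. }
    apply Rle_trans with (t * (sqrt G * sqrt E)).
    - apply Rmult_le_compat_l; lra.
    - right; transitivity (sqrt G * (t * sqrt E)); [ring | rewrite EE; ring]. }
  assert (Hnr : 1 <= INR n) by (apply (le_INR 1); lia).
  assert (Hlna : 0 < ln a) by (rewrite <- ln_1; apply ln_increasing; lra).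
  assert (Hln : ln a <= INR n * G').
  { assert (H : ln a <= ln (G * E)).
    { destruct (Rle_lt_or_eq_dec _ _ HcG) as [Hlt | Heq].
      - left; apply ln_increasing; lra.
      - rewrite Heq; lra. }
    rewrite ln_mult in H by auto; unfold E in H; rewrite ln_pow in H by lra.
    unfold G'; pose proof (Rle_abs (ln G)); pose proof (Rabs_pos (ln G)); nra. }
  assert (HK : forall k, 0 <= k -> k * sqrt G <= K1 + K2 + K3 + 1 ->
            k * t <= (K1 + K2 + K3 + 1) / sqrt a).
  { intros k Hk HkK; apply Rle_trans with (k * (sqrt G / sqrt a)).
    - apply Rmult_le_compat_l; auto.
    - unfold Rdiv; rewrite <- Rmult_assoc; apply Rmult_le_compat_r; auto.
      left; apply Rinv_0_lt_compat; auto. }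
  destruct (Herr (pow_elt e n)) as [m3 Hm3].
  exists c, (near_gen x), (near_gen2 x), m3; repeat split.
  - fold a; lra.
  - unfold c; rewrite near_gen_error, Rabs_Ropp.
    apply Rle_trans with (1 := Him); apply HK; auto; fold K1; lra.
  - unfold c; rewrite near_gen2_error.
    apply Rle_trans with ((Rabs (theta + u) * (s / v) + s) * t).
    + eapply Rle_trans; [apply Rabs_triang |].
      rewrite Rabs_Ropp, Rabs_mult, Rabs_Ropp.
      assert (Rabs (theta + u) * Rabs (im x / v) <= Rabs (theta + u) * (s / v * t))
        by (apply Rmult_le_compat_l; auto using Rabs_pos).
      lra.
    + apply HK; [| fold K2; lra].
      apply Rplus_le_le_0_compat; auto; apply Rmult_le_pos; auto using Rabs_pos.
  - apply Rle_trans with (1 := Hm3).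
    rewrite Eip, Rabs_mult, (Rabs_pos_eq t) by lra.
    assert (Hsl : Rabs (sin (INR n * w)) <= PI * G' / ln a).
    { apply Rle_trans with (1 := Hsin).
      apply Rmult_le_reg_r with (INR n * ln a); [nra |].
      replace (PI / INR n * (INR n * ln a)) with (PI * ln a) by (field; lra).
      replace (PI * G' / ln a * (INR n * ln a)) with (PI * (INR n * G')) by (field; lra).
      apply Rmult_le_compat_l; lra. }
    apply Rle_trans with (L * (sqrt G / sqrt a * (PI * G' / ln a))).
    + apply Rmult_le_compat_l; auto; apply Rmult_le_compat; auto using Rabs_pos; lra.
    + replace (L * (sqrt G / sqrt a * (PI * G' / ln a))) with (K3 / (sqrt a * ln a))
        by (unfold K3; field; lra).
      apply Rmult_le_compat_r; [| lra].
      left; apply Rinv_0_lt_compat, Rmult_lt_0_compat; auto.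
Qed.

End CubicRing.

Lemma is_rat_IZR (k : Z) : is_rat (IZR k).
Proof. exists (inject_Z k); unfold Q2R; simpl; field. Qed.

Lemma common_denominator (x y z : R) : is_rat x -> is_rat y -> is_rat z ->
  exists D a b c : Z, (0 < D)%Z /\
    IZR D * x = IZR a /\ IZR D * y = IZR b /\ IZR D * z = IZR c.
Proof.
  intros [[a d] ->] [[b e] ->] [[c f] ->]; unfold Q2R; simpl.
  pose proof (IZR_lt 0 _ (Pos2Z.is_pos d)); pose proof (IZR_lt 0 _ (Pos2Z.is_pos e)).
  pose proof (IZR_lt 0 _ (Pos2Z.is_pos f)).
  exists (Z.pos d * Z.pos e * Z.pos f)%Z, (a * Z.pos e * Z.pos f)%Z,
    (b * Z.pos d * Z.pos f)%Z, (c * Z.pos d * Z.pos e)%Z.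
  split; [lia |].
  rewrite !mult_IZR; repeat split; field; lra.
Qed.

Lemma integral_generator (theta : R) : cubic_one_real_generator theta ->
  exists (D p q r : Z) (u v : R), (0 < D)%Z /\
    let t := IZR D * theta in
    IZR p = - (t + 2 * u) /\
    IZR q = 2 * t * u + u * u + v * v /\
    IZR r = - t * (u * u + v * v) /\
    0 < v /\
    forall a b c : Z, IZR a + IZR b * t + IZR c * (t * t) = 0 ->
      a = 0%Z /\ b = 0%Z /\ c = 0%Z.
Proof.
  intros [(a & b & c & Ra & Rb & Rc & Hroot & Huniq) Hind].
  destruct (common_denominator a b c Ra Rb Rc) as (D & ka & kb & kc & HD & Ea & Eb & Ec).
  pose proof (IZR_lt _ _ HD) as HDr.
  set (t := IZR D * theta).
  set (u := - (IZR ka + t) / 2).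
  set (w := t * t + IZR ka * t + IZR (kb * D) - u * u).
  assert (Hw : 0 < w).
  { destruct (Rlt_dec 0 w) as [| Hw]; auto; exfalso.
    assert (Hy : forall d, d * d = - w -> (u + d) / IZR D = theta).
    { intros d Ed; apply Huniq.
      set (y := (u + d) / IZR D).
      assert (Ey : IZR D * y = u + d) by (unfold y; field; lra).
      apply Rmult_eq_reg_l with (IZR D * IZR D * IZR D);
        [| apply Rgt_not_eq; repeat apply Rmult_lt_0_compat; lra].
      rewrite Rmult_0_r.
      transitivity ((IZR D * y - t) * ((IZR D * y - u) * (IZR D * y - u) + w)
        + IZR D * IZR D * IZR D * (theta ^ 3 + a * theta ^ 2 + b * theta + c)).
      - unfold w; rewrite mult_IZR, <- Eb; unfold u; rewrite <- Ea; unfold t; field.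
      - rewrite Hroot, Ey; replace (u + d - u) with d by ring; rewrite Ed; ring. }
    assert (Hsq : sqrt (- w) * sqrt (- w) = - w) by (apply sqrt_sqrt; lra).
    pose proof (Hy _ Hsq) as Y1.
    pose proof (Hy (- sqrt (- w)) ltac:(lra)) as Y2.
    assert (Z1 : u + sqrt (- w) = t) by (unfold t; rewrite <- Y1; field; lra).
    assert (Z2 : u + - sqrt (- w) = t) by (unfold t; rewrite <- Y2; field; lra).
    destruct (Hind (IZR ka) (IZR (3 * D)) (IZR 0)) as (_ & H & _);
      try apply is_rat_IZR.
    - rewrite mult_IZR; replace (3 * IZR D * theta) with (3 * t) by (unfold t; ring).
      unfold u in Z1, Z2; lra.
    - rewrite mult_IZR in H; lra. }
  assert (Ev : sqrt w * sqrt w = w) by (apply sqrt_sqrt; lra).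
  exists D, ka, (kb * D)%Z, (kc * D * D)%Z, u, (sqrt w); split; [exact HD |].
  fold t; cbv zeta; rewrite !Ev; refine (conj _ (conj _ (conj _ (conj _ _)))).
  - unfold u; field.
  - unfold w, u; field.
  - unfold w; rewrite !mult_IZR, <- Ea, <- Eb, <- Ec.
    apply Rminus_diag_uniq.
    transitivity (IZR D * IZR D * IZR D * (theta ^ 3 + a * theta ^ 2 + b * theta + c));
      [unfold t; ring | rewrite Hroot; ring].
  - apply sqrt_lt_R0; auto.
  - intros x y z E.
    destruct (Hind (IZR x) (IZR (y * D)) (IZR (z * D * D))) as (X & Y & Z);
      try apply is_rat_IZR.
    + rewrite !mult_IZR; rewrite <- E; unfold t; ring.
    + apply eq_IZR in X, Y, Z; nia.
Qed.

Lemma in_Qtheta_integral_multiple (theta x : R) (D : Z) : (0 < D)%Z -> in_Qtheta theta x ->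
  exists N a b c : Z, (0 < N)%Z /\
    IZR N * x = IZR a + IZR b * (IZR D * theta)
                + IZR c * (IZR D * theta * (IZR D * theta)).
Proof.
  intros HD (x0 & x1 & x2 & R0 & R1 & R2 & ->).
  destruct (common_denominator _ _ _ R0 R1 R2) as (N & a & b & c & HN & E0 & E1 & E2).
  exists (N * D * D)%Z, (a * D * D)%Z, (b * D)%Z, c; split; [nia |].
  rewrite !mult_IZR, <- E0, <- E1, <- E2; ring.
Qed.

Lemma exists_increasing_sequence (P : nat -> Prop) :
  (forall n, exists s, (n < s)%nat /\ P s) ->
  exists s : nat -> nat, (forall n, (s n < s (S n))%nat) /\ forall n, P (s n).
Proof.
  intros H; apply functional_choice in H; destruct H as [f Hf].
  exists (fix s n := match n with O => f O | S k => f (s k) end); split.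
  - intros n; apply Hf.
  - intros [| n]; apply Hf.
Qed.

Lemma dist_nint_scaled (N c a b d m : Z) (s t x e : R) :
  IZR N * x = IZR a + IZR b * t + IZR d * (t * t) ->
  s = IZR N * Rabs (IZR c) ->
  Rabs (IZR c * (IZR b * t + IZR d * (t * t)) - IZR m) <= e ->
  dist_nint (s * x) <= e.
Proof.
  intros Ex -> He.
  set (y := IZR c * (IZR b * t + IZR d * (t * t)) - IZR m) in He.
  assert (Ey : IZR N * IZR c * x - IZR (c * a + m) = y).
  { unfold y; rewrite plus_IZR, mult_IZR.
    transitivity (IZR c * (IZR N * x) - (IZR c * IZR a + IZR m)); [ring | rewrite Ex; ring]. }
  unfold Rabs at 1; destruct (Rcase_abs (IZR c)).
  - apply Rle_trans with (1 := dist_nint_le_Rabs _ (- (c * a + m))).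
    rewrite opp_IZR; replace (_ - _) with (- y) by (rewrite <- Ey; ring).
    rewrite Rabs_Ropp; exact He.
  - apply Rle_trans with (1 := dist_nint_le_Rabs _ (c * a + m)).
    rewrite Ey; exact He.
Qed.

Theorem theorem3 (theta : R) (hK : cubic_one_real_generator theta)
  (alpha beta : R) (ha : in_Qtheta theta alpha) (hb : in_Qtheta theta beta) :
  exists s : nat -> nat, peck_sequence s alpha beta.
Proof.
  destruct (integral_generator theta hK) as
    (D & p & q & r & u & v & HD & Hp & Hq & Hr & Hv & Hind).
  destruct (in_Qtheta_integral_multiple theta alpha D HD ha) as (Na & a0 & a1 & a2 & HNa & Ea).
  destruct (in_Qtheta_integral_multiple theta beta D HD hb) as (Nb & b0 & b1 & b2 & HNb & Eb).
  set (t := IZR D * theta) in *.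
  set (N := (Na * Nb)%Z).
  set (A1 := (Nb * a1)%Z); set (A2 := (Nb * a2)%Z).
  set (B1 := (Na * b1)%Z); set (B2 := (Na * b2)%Z).
  assert (HN : (0 < N)%Z) by (unfold N; nia).
  assert (EA : IZR N * alpha = IZR (Nb * a0) + IZR A1 * t + IZR A2 * (t * t)).
  { unfold N, A1, A2; rewrite !mult_IZR.
    transitivity (IZR Nb * (IZR Na * alpha)); [ring | rewrite Ea; ring]. }
  assert (EB : IZR N * beta = IZR (Na * b0) + IZR B1 * t + IZR B2 * (t * t)).
  { unfold N, B1, B2; rewrite !mult_IZR.
    transitivity (IZR Na * (IZR Nb * beta)); [ring | rewrite Eb; ring]. }
  destruct (good_multiples p q r t u v Hp Hq Hr Hv Hind A1 A2) as (K & HK & Hgood).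
  pose proof (IZR_lt _ _ HN) as HNr.
  assert (HsN : 0 < sqrt (IZR N)) by (apply sqrt_lt_R0; auto).
  set (W := Rabs (IZR A1) + Rabs (IZR A2) + Rabs (IZR B1) + Rabs (IZR B2)).
  assert (HW : 0 <= W)
    by (unfold W; repeat apply Rplus_le_le_0_compat; apply Rabs_pos).
  set (M1 := sqrt (IZR N) * (W * K + 1)).
  set (M2 := 2 * sqrt (IZR N) * (K + 1)).
  destruct (exists_increasing_sequence (fun s =>
    (2 <= s)%nat /\
    Rmax (dist_nint (INR s * alpha)) (dist_nint (INR s * beta)) < M1 / sqrt (INR s) /\
    dist_nint (INR s * alpha) < M2 / (sqrt (INR s) * ln (INR s)))) as (s & Hinc & Hs).
  { intros n.
    destruct (Hgood (INR n + IZR N + 2)) as (c & m1 & m2 & m3 & HT & H1 & H2 & H3).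
    pose proof (pos_INR n) as Hn.
    set (s := Z.to_nat (N * Z.abs c)).
    assert (Es : INR s = IZR N * Rabs (IZR c)).
    { unfold s; rewrite INR_IZR_INZ, Z2Nat.id by lia; rewrite mult_IZR, abs_IZR; auto. }
    assert (HN1 : 1 <= IZR N) by (apply IZR_le; lia).
    set (a := Rabs (IZR c)) in *.
    assert (Hsn : INR n + 2 < INR s) by (rewrite Es; nra).
    assert (Hsa : 0 < sqrt a) by (apply sqrt_lt_R0; lra).
    assert (Ess : sqrt (INR s) = sqrt (IZR N) * sqrt a) by (rewrite Es; apply sqrt_mult; lra).
    assert (Hlin : forall b d x k0, IZR N * x = IZR k0 + IZR b * t + IZR d * (t * t) ->
              Rabs (IZR b) + Rabs (IZR d) <= W ->
              dist_nint (INR s * x) < M1 / sqrt (INR s)).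
    { intros b d x k0 E HbdW.
      apply Rle_lt_trans with (W * (K / sqrt a)).
      - apply (dist_nint_scaled N c k0 b d (b * m1 + d * m2) _ t); auto.
        rewrite plus_IZR, !mult_IZR.
        replace (_ - _) with (IZR b * (IZR c * t - IZR m1) + IZR d * (IZR c * (t * t) - IZR m2))
          by ring.
        eapply Rle_trans; [apply Rabs_triang |]; rewrite !Rabs_mult.
        apply Rle_trans with (Rabs (IZR b) * (K / sqrt a) + Rabs (IZR d) * (K / sqrt a)).
        + apply Rplus_le_compat; apply Rmult_le_compat_l; auto using Rabs_pos.
        + rewrite <- Rmult_plus_distr_r; apply Rmult_le_compat_r; auto.
          apply Rlt_le, Rdiv_lt_0_compat; auto.
      - rewrite Ess; unfold M1.
        replace (sqrt (IZR N) * (W * K + 1) / (sqrt (IZR N) * sqrt a))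
          with (W * (K / sqrt a) + / sqrt a) by (field; lra).
        pose proof (Rinv_0_lt_compat _ Hsa); lra. }
    pose proof (Rabs_pos (IZR A1)); pose proof (Rabs_pos (IZR A2)).
    pose proof (Rabs_pos (IZR B1)); pose proof (Rabs_pos (IZR B2)).
    exists s; repeat split.
    - apply INR_lt; lra.
    - apply INR_le; simpl; lra.
    - apply Rmax_lub_lt; eapply Hlin; eauto; unfold W; lra.
    - apply Rle_lt_trans with (1 := dist_nint_scaled N c _ A1 A2 m3 _ t _ _ EA Es H3).
      assert (Hln0 : 0 < ln a) by (rewrite <- ln_1; apply ln_increasing; lra).
      assert (Hlns0 : 0 < ln (INR s)) by (rewrite <- ln_1; apply ln_increasing; lra).
      assert (Hlns : ln (INR s) <= 2 * ln a).
      { rewrite Es, ln_mult by lra.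
        assert (ln (IZR N) < ln a) by (apply ln_increasing; lra); lra. }
      rewrite Ess.
      apply Rlt_le_trans with ((K + 1) / (sqrt a * ln a)).
      + apply Rmult_lt_compat_r; [| lra].
        apply Rinv_0_lt_compat, Rmult_lt_0_compat; auto.
      + replace (M2 / (sqrt (IZR N) * sqrt a * ln (INR s)))
          with ((K + 1) / sqrt a * (2 * / ln (INR s))) by (unfold M2; field; lra).
        replace ((K + 1) / (sqrt a * ln a)) with ((K + 1) / sqrt a * / ln a) by (field; lra).
        apply Rmult_le_compat_l; [apply Rlt_le, Rdiv_lt_0_compat; lra |].
        apply Rmult_le_reg_r with (ln a * ln (INR s)); [apply Rmult_lt_0_compat; auto |].
        replace (/ ln a * (ln a * ln (INR s))) with (ln (INR s)) by (field; lra).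
        replace (2 * / ln (INR s) * (ln a * ln (INR s))) with (2 * ln a) by (field; lra).
        exact Hlns. }
  exists s; split; [| split; [exact Hinc |]].
  - intros n; destruct (Hs n); lia.
  - exists M1, M2; split; [| split].
    + apply Rmult_lt_0_compat; nra.
    + repeat apply Rmult_lt_0_compat; lra.
    + exists (fun n => n); split; [lia |].
      split; [| split]; intros n; apply (Hs n).
Qed.
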